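(* Let $G$ be a finitely generated group, and let $S$ be a finite symmetric generating set for $G$ containing the identity and satisfying $\frac{|S^{n+1}|}{|S^n|}\to1$ as $n\to\infty$. Then the following hold. (1) If $\textup{dc}_S(G)>\frac{5}{8}$ then $G$ is abelian. (2) If $\textup{dc}_S(G)\ge\frac{1}{2}+\varepsilon$ for some $\varepsilon>0$ then the centre of $G$ has index at most $\frac{1}{\varepsilon}$ in $G$. (3) There is an absolute constant $C>0$ such that if $\textup{dc}_S(G)\ge\alpha>0$ then $G$ has a normal subgroup $\Gamma$ of index at most $\lceil\alpha^{-1}\rceil$ and a normal subgroup $H$ of cardinality at most $\exp(C\alpha^{-C})$ such that $H\subset\Gamma$ and $\Gamma/H$ is abelian.
   Context: For a probability measure $\mu$ on a group $G$, $\textup{dc}_\mu(G)=(\mu\times\mu)(\{(x,y)\in G\times G:xy=yx\})$. $\textup{dc}_S(G)=\limsup_{n\to\infty}\textup{dc}_{\mu_n}(G)$, where $\mu_n$ is the uniform probability measure on $S^n=\{s_1\cdots s_n:s_i\in S\}$. *)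

(* Defs.v *)
From HB Require Import structures.
From mathcomp Require Import all_boot all_order all_algebra.
From mathcomp Require Import all_classical all_reals.
From mathcomp Require Import topology normedtype sequences exp.
Set Implicit Arguments. Unset Strict Implicit. Unset Printing Implicit Defensive.
Import Order.TTheory GRing.Theory Num.Theory numFieldNormedType.Exports.
Local Open Scope classical_set_scope.
Local Open Scope ring_scope.

Section Defs.
Variable G : groupType.
Implicit Types (S A : seq G) (H : G -> Prop).

Definition spow S (n : nat) : seq G :=
  undup (iter n (fun A => [seq (x * y)%g | x <- A, y <- S]) [:: 1%g]).

Definition ncomm A : nat :=
  count (fun p : G * G => (p.1 * p.2 == p.2 * p.1)%g) [seq (x, y) | x <- A, y <- A].

Variable R : realType.

(* dc_{mu_n}(G), mu_n the uniform probability measure on the finite set S^n *)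
Definition dc_n S (n : nat) : R :=
  (ncomm (spow S n))%:R / ((size (spow S n)) ^ 2)%:R.

Definition dcS S : R := limn_sup (dc_n S).

Definition good_genset S : Prop :=
  [/\ (1%g \in S), (forall x, x \in S -> (x^-1)%g \in S),
      (forall g : G, exists n, g \in spow S n) &
      ((fun n => ((size (spow S n.+1))%:R / (size (spow S n))%:R : R)) @ \oo --> (1 : R))].

Definition is_subgroup H : Prop :=
  [/\ H 1%g, (forall x y, H x -> H y -> H (x * y)%g) & (forall x, H x -> H (x^-1)%g)].

Definition is_normal_subgroup H : Prop :=
  is_subgroup H /\ forall g h, H h -> H (g^-1 * h * g)%g.

Definition center_of : G -> Prop := fun z => forall g : G, (z * g = g * z)%g.

Definition subgroup_index_le H (b : R) : Prop :=
  exists s : seq G, ((size s)%:R <= b) /\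
    forall g : G, exists2 x, x \in s & exists h, H h /\ g = (x * h)%g.

Definition fincard_le H (b : R) : Prop :=
  exists s : seq G, [/\ uniq s, (forall x, H x <-> x \in s) & (size s)%:R <= b].

End Defs.

(* Main.v *)
Require Import Defs.
From HB Require Import structures.
From mathcomp Require Import all_boot all_order all_algebra.
From mathcomp Require Import all_classical all_reals.
From mathcomp Require Import topology normedtype sequences exp.
From mathcomp Require Import all_fingroup cyclic zify ring lra.
Set Implicit Arguments. Unset Strict Implicit. Unset Printing Implicit Defensive.
Import Order.TTheory GRing.Theory Num.Theory numFieldNormedType.Exports.
Local Open Scope ring_scope.

(* A subgroup of index at least [q] has [q] distinct cosets meeting [S^q], so
   [|S^(n+1)|/|S^n| -> 1] gives it [mu_n]-measure at most [1/q + o(1)],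
   uniformly in the subgroup.  Averaging the measures of the centralisers
   yields (1) and (2).

   For (3) let [k] be the ceiling of [1/alpha], [r = 2k(k+1)], and [X] the
   set of elements with at most [r] conjugates.  The density of [X] exceeds
   [1/(k+1)] for infinitely many [n], so [Gam = <X>] has index at most [k] and
   is [X^(3k)].  Polynomially many (in [k]) elements of [X] generate a normal
   subgroup [K] that acts transitively on a largest conjugacy class of [Gam]
   and satisfies [Gam = K C], where the elements of [C] are central modulo
   [[K,K]]; hence [[Gam,Gam] = [K,K]].  Now [K] is generated by a normal set [Y]
   of polynomial size [M].  The transfer of [K] into its centre shows that
   commutators in [K] have order at most [(M!)^2], and Dietzmann's lemma, applied
   to the at most [M^2] commutators of elements of [Y], bounds the size of [[K,K]]
   by [(M!)^(2M^2)], which is exponential in a polynomial of [k]. *)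

(** * Subgroups, packings by cosets, and normal generation *)

Lemma max_nat (P : nat -> Prop) b :
  (exists n, P n) -> (forall n, P n -> (n <= b)%N) ->
  exists2 n, P n & forall m, P m -> (m <= n)%N.
Proof.
move=> exP leP.
have exP' : exists n, `[<P n>] by have [n Pn] := exP; exists n; apply/asboolP.
have leP' n : `[<P n>] -> (n <= b)%N by move=> /asboolP; exact: leP.
case: (ex_maxnP exP' leP') => n /asboolP Pn nmax; exists n => // m Pm.
by apply: nmax; apply/asboolP.
Qed.

Lemma leq_size_rel (T U : eqType) (s : seq T) (c : seq U) (r : T -> U -> Prop) :
  uniq s ->
  (forall x, x \in s -> exists2 y, y \in c & r x y) ->
  (forall x x' y, x \in s -> x' \in s -> r x y -> r x' y -> x = x') ->
  (size s <= size c)%N.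
Proof.
case: c => [|y0 c] us tot inj.
  by case: s us tot inj => // x s _ /(_ x (mem_head x s)) [].
pose f x := nth y0 (y0 :: c) (find (fun y => `[<r x y>]) (y0 :: c)).
have hasf x : x \in s -> has (fun y => `[<r x y>]) (y0 :: c).
  by move=> /tot [y yc rxy]; apply/hasP; exists y => //; apply/asboolP.
have rf x : x \in s -> r x (f x) by move=> /hasf /(nth_find y0) /asboolP.
rewrite -(size_map f); apply: uniq_leq_size.
  rewrite map_inj_in_uniq // => x x' xs x's fE.
  by apply: (inj _ _ (f x)) => //; [exact: rf|rewrite fE; exact: rf].
by move=> _ /mapP [x xs ->]; rewrite mem_nth // -has_find; exact: hasf.
Qed.

Section Groups.
Variable G : groupType.
Implicit Types (X A B D H K Gam : G -> Prop) (s c L Y Z : seq G).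
Local Open Scope group_scope.

Inductive gen X : G -> Prop :=
| gen_in x of X x : gen X x
| gen1 : gen X 1
| genM x y of gen X x & gen X y : gen X (x * y)
| genV x of gen X x : gen X x^-1.

Lemma gen_subgroup X : is_subgroup (gen X).
Proof. by split; [exact: gen1|exact: genM|exact: genV]. Qed.

Lemma gen_sub X D : is_subgroup D -> (forall x, X x -> D x) ->
  forall x, gen X x -> D x.
Proof. by move=> [D1 DM DV] XD x; elim=> [y||y z _ Dy _|y _]; [exact: XD| |exact: DM|exact: DV]. Qed.

Lemma gen_mono X D : (forall x, X x -> D x) -> forall x, gen X x -> gen D x.
Proof. by move=> XD; apply: (gen_sub (gen_subgroup D)) => x /XD; exact: gen_in. Qed.

Lemma gen_conjg X : (forall x g, X x -> X (x ^ g)) ->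
  forall x g, gen X x -> gen X (x ^ g).
Proof.
move=> XJ x g; elim=> [y /XJ Xy||y z _ IHy _ IHz|y _ IHy].
- exact: gen_in.
- by rewrite conj1g; exact: gen1.
- by rewrite conjMg; exact: genM.
- by rewrite conjVg; exact: genV.
Qed.

Lemma gen_normal X : (forall x g, X x -> X (x ^ g)) -> is_normal_subgroup (gen X).
Proof.
move=> XJ; split; first exact: gen_subgroup.
by move=> g h; rewrite -mulgA; exact: gen_conjg.
Qed.

Lemma normal_conjg H x g : is_normal_subgroup H -> H x -> H (x ^ g).
Proof. by move=> [_ HJ] Hx; rewrite conjgE mulgA; exact: HJ. Qed.

Lemma subgroup_commute A : is_subgroup (fun g => forall a, A a -> commute g a).
Proof.
split=> [a _|x y xA yA a Aa|x xA a Aa].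
- exact/commute_sym/commute1.
- by apply/commute_sym/commuteM; apply/commute_sym; [exact: xA|exact: yA].
- exact/commute_sym/commuteV/commute_sym/xA.
Qed.

Lemma subgroup_commute1 (x : G) : is_subgroup (commute x).
Proof. by split=> [|y z|y]; [exact: commute1|exact: commuteM|exact: commuteV]. Qed.

(** For fixed [b], the [a] with [[~ a, b]] in [H] form a subgroup, by [[~ x * y, b] = [~ x, b] ^ y *
    [~ y, b]] and normality. Since [[~ a, b]^-1 = [~ b, a]], the same argument serves the second
    variable. *)
Lemma commg_gen A B H : is_normal_subgroup H ->
  (forall a b, A a -> B b -> H [~ a, b]) ->
  forall a b, gen A a -> gen B b -> H [~ a, b].
Proof.
move=> nH; have [[H1 HM HV] _] := nH.
have sub b : is_subgroup (fun a => H [~ a, b]).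
  split=> [|x y Hx Hy|x Hx]; first by rewrite comm1g.
    have -> : [~ x * y, b] = [~ x, b] ^ y * [~ y, b].
      by rewrite !commgEl !conjgE !gnorm.
    by apply: HM => //; exact: normal_conjg.
  have -> : [~ x^-1, b] = ([~ x, b] ^ x^-1)^-1.
    by rewrite !commgEl !conjgE !gnorm.
  by apply: HV; apply: normal_conjg.
have half A' B' : (forall a b, A' a -> B' b -> H [~ a, b]) ->
    forall a b, gen A' a -> B' b -> H [~ a, b].
  move=> AB a b Aa Bb; apply: (gen_sub (sub b) _ Aa) => x Ax; exact: AB.
move=> AB a b Aa Bb; rewrite -invgR; apply: (HV); apply: (half B (gen A)) => //.
by move=> y x By Ax; rewrite -invgR; apply: HV; exact: (half A B).
Qed.

(** The list only has to contain the conjugacy class of [g], so lists of products can be used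
    without pruning. *)
Definition classle (g : G) (b : nat) : Prop :=
  exists2 c : seq G, (size c <= b)%N & forall h, g ^ h \in c.

Lemma classleM g h a b : classle g a -> classle h b -> classle (g * h) (a * b).
Proof.
move=> [c ca gc] [d db hd]; exists [seq x * y | x <- c, y <- d].
  by rewrite size_allpairs leq_mul.
by move=> x; rewrite conjMg; apply/allpairsP; exists (g ^ x, h ^ x); split=> /=; [exact: gc|exact: hd|].
Qed.

(** For a subgroup [D] the elements of [s] represent distinct left cosets. The definition also
    serves the set of products [p * q] with [p], [q] in a symmetric set [X]; there it says that the
    translates of [X] by [s] are pairwise disjoint. *)
Definition packing Gam D s : Prop :=
  [/\ uniq s, forall x, x \in s -> Gam x &
      forall x y, x \in s -> y \in s -> D (x^-1 * y) -> x = y].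

Definition index_le Gam D (b : nat) : Prop :=
  forall s, packing Gam D s -> (size s <= b)%N.

Lemma packing_cons Gam D s g : is_subgroup D -> packing Gam D s -> Gam g ->
  (forall x, x \in s -> ~ D (x^-1 * g)) -> packing Gam D (g :: s).
Proof.
move=> [D1 DM DV] [us sG sD] Gg gs; split.
- by rewrite /= us andbT; apply/negP => /gs; rewrite mulVg.
- by move=> x /[!inE] /orP[/eqP ->|/sG].
- move=> x y /[!inE] /orP[/eqP->|xs] /orP[/eqP->|ys] //; last exact: sD.
    by move=> /DV; rewrite invgM invgK => /(gs _ ys).
  by move=> /(gs _ xs).
Qed.

(** A packing of greatest size covers [Gam], since an uncovered element could be added to it. *)
Lemma packing_cover Gam D b : is_subgroup D -> index_le Gam D b ->
  exists2 s, packing Gam D s &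
    forall g, Gam g -> exists2 x, x \in s & D (x^-1 * g).
Proof.
move=> sD Db.
have [||n [s [ps <-]] smax] :=
  @max_nat (fun n => exists s, packing Gam D s /\ size s = n) b.
- by exists 0%N, [::].
- by move=> n [s [ps <-]]; exact: Db.
exists s => // g Gg; apply: contrapT => nx.
have /(packing_cons sD ps Gg) pgs : forall x, x \in s -> ~ D (x^-1 * g).
  by move=> x xs Dx; apply: nx; exists x.
by have := smax (size s).+1; rewrite ltnn; apply/not_implyP; split=> //; exists (g :: s).
Qed.

(** The conjugate [g ^ x^-1] depends only on the coset of [x] modulo [D], so a covering packing
    yields all conjugates. *)
Lemma classle_index D g b : is_subgroup D -> (forall d, D d -> commute g d) ->
  index_le (fun=> True) D b -> classle g b.
Proof.
move=> sD Dg Db; have [s ps cov] := packing_cover sD Db.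
exists [seq g ^ x^-1 | x <- s]; first by rewrite size_map; exact: Db.
move=> h; have [//|x xs Dx] := cov h^-1; apply/mapP; exists x => //.
by have /Dg /commgP/conjg_fixP := Dx; rewrite conjgM => /(canRL (conjgK _)) ->; rewrite invgK.
Qed.

Lemma classle_packing Gam g s b : classle g b ->
  packing Gam (fun d => commute g d) s -> (size s <= b)%N.
Proof.
move=> [c cb gc] [us _ sg]; apply: leq_trans cb.
apply: (leq_size_rel (r := fun x y => y = g ^ x^-1)) => // [x _|x x' y xs x's -> E].
  by exists (g ^ x^-1).
apply: sg => //; apply/commgP/conjg_fixP; rewrite conjgM E.
by rewrite -conjgM mulVg conjg1.
Qed.

Definition nclos L : G -> Prop :=
  gen (fun y => exists2 x, x \in L & exists g, y = x ^ g).

Lemma nclos_conjg L x g : nclos L x -> nclos L (x ^ g).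
Proof.
by apply: gen_conjg => y h [z zL [k ->]]; exists z => //; exists (k * h); rewrite conjgM.
Qed.

Lemma nclos_sub L K : is_normal_subgroup K -> (forall x, x \in L -> K x) ->
  forall x, nclos L x -> K x.
Proof.
move=> nK LK; apply: gen_sub; first by case: nK.
by move=> _ [x xL [g ->]]; apply: normal_conjg => //; exact: LK.
Qed.

Lemma nclos_mem L x : x \in L -> nclos L x.
Proof. by move=> xL; apply: gen_in; exists x => //; exists 1; rewrite conjg1. Qed.

Lemma nclos_normal L : is_normal_subgroup (nclos L).
Proof.
split; first exact: gen_subgroup.
by move=> g h; rewrite -mulgA; exact: nclos_conjg.
Qed.

Lemma nclos_mono L L' x : {subset L <= L'} -> nclos L x -> nclos L' x.
Proof. by move=> LL'; apply: gen_mono => y [z zL yE]; exists z => //; exact: LL'. Qed.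

(* Each normal generator outside [D] at least halves the index of [D]. *)
Lemma normal_generators Gam X D t : is_subgroup D -> is_subgroup Gam ->
  (forall x, X x -> Gam x) -> (forall g, Gam g -> gen X g) ->
  index_le Gam D (2 ^ t) ->
  exists L, [/\ (size L <= t)%N, forall x, x \in L -> X x &
    forall g, Gam g -> exists n d, [/\ nclos L n, D d & g = n * d]].
Proof.
move=> + [G1 GM GV] XG genX; elim: t D => [|t IH] D sD Dt; have [D1 DM DV] := sD.
  exists [::]; split=> // g Gg; exists 1, g; split; [exact: gen1| |by rewrite mul1g].
  apply: contrapT => nDg.
  have /Dt : packing Gam D [:: g; 1] => //.
  apply: packing_cons => //; last by move=> x /[!inE] /eqP->; rewrite invg1 mul1g.
  split=> // [x|x y]; first by rewrite inE => /eqP->.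
  by rewrite !inE => /eqP-> /eqP->.
have [XD|] := pselect (forall x, X x -> D x).
  exists [::]; split=> // g /genX /(gen_sub sD XD) Dg.
  by exists 1, g; split=> //; [exact: gen1|rewrite mul1g].
move=> /existsNP [x /not_implyP [Xx nDx]].
pose N := nclos [:: x].
have [[N1 NM NV] _] := nclos_normal [:: x].
have NJ n g : N n -> N (n ^ g) by exact: nclos_conjg.
have Nx : N x by apply: nclos_mem; rewrite inE.
pose D' g := exists n d, [/\ N n, D d & g = n * d].
have D'I n d : N n -> D d -> D' (n * d) by move=> Nn Dd; exists n, d.
have DD' d : D d -> D' d by move=> Dd; rewrite -[d]mul1g; exact: D'I.
have ND' n : N n -> D' n by move=> Nn; rewrite -[n]mulg1; exact: D'I.
have sD' : is_subgroup D'.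
  split; first exact: DD'.
    move=> _ _ [n [d [Nn Dd ->]]] [n' [d' [Nn' Dd' ->]]].
    have -> : n * d * (n' * d') = n * n' ^ d^-1 * (d * d') by rewrite conjgE !gnorm.
    by apply: D'I; [apply: NM => //; exact: NJ|exact: DM].
  move=> _ [n [d [Nn Dd ->]]].
  have -> : (n * d)^-1 = n^-1 ^ d * d^-1 by rewrite conjgE !gnorm.
  by apply: D'I; [apply/NJ/NV|exact: DV].
have [_ D'M D'V] := sD'.
(* A packing [s] for [D'] doubles to the packing [s], [s x] for [D], because [x] lies in [D'] but
   not in [D]. *)
have D't : index_le Gam D' (2 ^ t).
  move=> s [us sG sD''].
  rewrite -(leq_pmul2l (ltn0Sn 1)) -expnS mul2n -addnn.
  rewrite -{2}(size_map (fun y => y * x) s) -size_cat; apply: Dt.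
  have sep y z : y \in s -> z \in s -> D (y^-1 * (z * x)) -> False.
    move=> ys zs Dyz; have yz : y = z.
      apply: sD'' => //.
      have -> : y^-1 * z = y^-1 * (z * x) * x^-1 by rewrite !gnorm.
      by apply: D'M; [exact: DD'|exact/D'V/ND'].
    by move: Dyz; rewrite yz mulKg.
  split.
  - rewrite cat_uniq us /= map_inj_uniq; last exact: mulIg.
    rewrite us andbT; apply/hasPn => _ /mapP [y ys ->]; apply/negP => yxs.
    by apply: (sep _ _ yxs ys); rewrite mulVg.
  - move=> y; rewrite mem_cat => /orP[/sG //|/mapP[z /sG Gz ->]].
    by apply: GM => //; exact: XG.
  - move=> y z; rewrite !mem_cat => /orP[ys|/mapP[y' ys ->]] /orP[zs|/mapP[z' zs ->]] Dyz.
    + by apply: sD'' => //; exact: DD'.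
    + by case: (sep _ _ ys zs Dyz).
    + by case: (sep _ _ zs ys); have := DV _ Dyz; rewrite invgM invgK.
    + congr (_ * x); apply: sD'' => //.
      have -> : y'^-1 * z' = x * ((y' * x)^-1 * (z' * x)) * x^-1 by rewrite !gnorm.
      by apply: (D'M); [apply: (D'M); [exact: ND'|exact: DD']|exact/D'V/ND'].
have [L [Lt LX cov]] := IH D' sD' D't.
exists (x :: L); split=> //.
  by move=> y /[!inE] /orP[/eqP->|/LX].
move=> g /cov [n [_ [Ln [n' [d [Nn' Dd ->]]] ->]]].
exists (n * n'), d; split=> //; last by rewrite mulgA.
apply: genM; first by apply: nclos_mono Ln => y yL; rewrite inE yL orbT.
by apply: nclos_mono Nn' => y; rewrite !inE => ->.
Qed.

End Groups.

(** * Groups generated by a finite normal set *)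

Section FiniteNormalSet.
Variable G : groupType.
Local Open Scope group_scope.

Lemma prodg_perm_commute (s t : seq G) : perm_eq s t ->
  {in s &, forall x y, commute x y} -> \prod_(x <- s) x = \prod_(x <- t) x.
Proof.
move=> pst cs.
suff [] : {in t &, forall x y, commute x y} /\ \prod_(x <- s) x = \prod_(x <- t) x by [].
apply: (catCA_perm_ind (P := fun t => {in t &, forall x y, commute x y} /\
   \prod_(x <- s) x = \prod_(x <- t) x)) pst _ => // s1 s2 s3 [c ->]; split.
  have sub : s2 ++ s1 ++ s3 =i s1 ++ s2 ++ s3 by move=> x; rewrite !mem_cat orbCA.
  by move=> x y; rewrite !sub; exact: c.
rewrite !big_cat /= !mulgA; congr (_ * _).
suff : commute (\prod_(x <- s1) x) (\prod_(x <- s2) x) by [].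
rewrite [X in commute X _]big_seq [X in commute _ X]big_seq.
apply: commute_prod => y ys2; apply/commute_sym/commute_prod => x xs1.
by apply: c; rewrite !mem_cat ?xs1 ?ys2 ?orbT.
Qed.

Fixpoint power_products e (Z : seq G) : seq G :=
  if Z is z :: Z' then [seq z ^+ i * d | i <- iota 0 e, d <- power_products e Z']
  else [:: 1].

Lemma size_power_products e Z : size (power_products e Z) = (e ^ size Z)%N.
Proof. by elim: Z => //= z Z IH; rewrite size_allpairs size_iota IH expnS. Qed.

(* Choose the first letter of a word representing the given product, among
   all words of the same length, as small as possible: by [x y = y x^y] no
   smaller letter can occur later in the word. *)
Lemma sorted_word (Z w : seq G) : uniq Z ->
  {in Z &, forall x y, x ^ y \in Z} -> {subset w <= Z} ->
  exists v : seq nat, [/\ size v = size w, sorted leq v,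
    all (fun i => i < size Z)%N v & \prod_(i <- v) Z`_i = \prod_(x <- w) x].
Proof.
move=> uZ ZJ; move En: (size w) => L; elim: L w En => [|L IH] w.
  by case: w => // _ _; exists [::]; rewrite !big_nil.
case: w => [//|x0 w0] [sw] wZ.
pose P i := `[<exists x w, [/\ size w = L, {subset x :: w <= Z},
  index x Z = i & \prod_(y <- x :: w) y = \prod_(y <- x0 :: w0) y]>].
have exP : exists i, P i by exists (index x0 Z); apply/asboolP; exists x0, w0.
have [i /asboolP [x [w [wL xwZ xi wE]]] imin] := ex_minnP exP.
have xZ : x \in Z by apply: xwZ; rewrite inE eqxx.
have [//||v [sv pv av vE]] := IH w; first by move=> y yw; apply: xwZ; rewrite inE yw orbT.
exists (i :: v); split=> /=.
- by rewrite sv.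
- case: v sv pv av vE => [//|j v] /= sv pv /andP[jZ av]; rewrite big_cons => vE.
  rewrite pv andbT leqNgt; apply/negP => ji.
  suff /imin : P j by rewrite leqNgt ji.
  have zZ k : (k < size Z)%N -> Z`_k \in Z by exact: mem_nth.
  apply/asboolP; exists Z`_j, (x ^ Z`_j :: [seq Z`_k | k <- v]); split.
  + by rewrite /= size_map.
  + move=> y; rewrite !inE => /orP[/eqP->|/orP[/eqP->|/mapP [k kv ->]]]; first exact: zZ.
      by apply: ZJ => //; exact: zZ.
    by apply: zZ; move/allP: av; apply.
  + by rewrite index_uniq.
  + by rewrite -wE !big_cons big_map mulgA -conjgC -mulgA vE.
- by rewrite av andbT -xi index_mem.
- by rewrite -wE !big_cons vE -xi nth_index.
Qed.

Lemma expg_modn (x : G) e n : x ^+ e = 1 -> x ^+ (n %% e) = x ^+ n.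
Proof.
by move=> xe; rewrite [in RHS](divn_eq n e) expgnDr mulnC expgnA xe expg1n mul1g.
Qed.

(** In a nondecreasing word equal letters stand together. The block of the letter numbered [j] is
    split off, its length is reduced modulo [e], and the rest uses later letters only. *)
Lemma sorted_power_products e (Z : seq G) (v : seq nat) j : (0 < e)%N ->
  (forall z, z \in Z -> z ^+ e = 1) -> (j <= size Z)%N -> sorted leq v ->
  all (fun i => j <= i < size Z)%N v ->
  \prod_(i <- v) Z`_i \in power_products e (drop j Z).
Proof.
move=> e0 Ze; move En: (size Z - j)%N => n.
elim: n j v En => [|n IH] j v En jZ sv av.
  have jE : j = size Z by apply/eqP; rewrite eqn_leq jZ -subn_eq0 En.
  case: v av sv => [_ _|i v /= /andP[/andP[ji iZ] _]].
    by rewrite big_nil jE drop_size inE.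
  by move: (leq_ltn_trans ji iZ); rewrite jE ltnn.
have jZ' : (j < size Z)%N by rewrite -subn_gt0 En.
have [c [v' [sv' av' ->]]] : exists c v', [/\ sorted leq v',
    all (fun i => j.+1 <= i < size Z)%N v' &
    \prod_(i <- v) Z`_i = Z`_j ^+ c * \prod_(i <- v') Z`_i].
  elim: v sv av => [_ _|i v IHv sv /= /andP[/andP[ji iZ] av]].
    by exists 0%N, [::]; rewrite !big_nil mulg1.
  have [ij|ji'] := eqVneq i j.
    have [c [v' [sv' av' E]]] := IHv (path_sorted sv) av.
    by exists c.+1, v'; rewrite big_cons E ij mulgA -expgS.
  exists 0%N, (i :: v); rewrite mul1g; split=> //.
  have lji : (j < i)%N by rewrite ltn_neqAle eq_sym ji' ji.
  rewrite /= lji iZ /=; apply/allP => k kv.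
  have /andP[_ ->] := allP av _ kv; rewrite andbT (leq_trans lji) //.
  by have /allP/(_ _ kv) := order_path_min leq_trans sv.
rewrite (drop_nth 1 jZ') /=; apply/allpairsP.
exists ((c %% e)%N, \prod_(i <- v') Z`_i); split=> /=.
- by rewrite mem_iota add0n ltn_mod.
- by apply: IH => //; rewrite subnS En.
- by rewrite expg_modn //; apply: Ze; exact: mem_nth.
Qed.

Lemma dietzmann e (Z w : seq G) : uniq Z ->
  {in Z &, forall x y, x ^ y \in Z} -> (0 < e)%N ->
  (forall z, z \in Z -> z ^+ e = 1) -> {subset w <= Z} ->
  \prod_(x <- w) x \in power_products e Z.
Proof.
move=> uZ ZJ e0 Ze wZ; have [v [_ sv av <-]] := sorted_word uZ ZJ wZ.
by have := @sorted_power_products e Z v 0 e0 Ze (leq0n _) sv av; rewrite drop0.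
Qed.

(** * The conjugation action on a finite normal set, and the transfer *)

Section ConjugationAction.
Variable Y : seq G.
Hypothesis uY : uniq Y.
Hypothesis YJ : forall y g, y \in Y -> y ^ g \in Y.
Let T := seq_sub Y.

Definition conj_fun (g : G) (y : T) : T := SeqSub (YJ g (ssvalP y)).

Lemma conj_fun_inj g : injective (conj_fun g).
Proof. by move=> x y /(congr1 val) /= /conjg_inj xy; exact: val_inj. Qed.

Definition conj_perm g : {perm T} := perm (@conj_fun_inj g).

Lemma conj_permM g h : conj_perm (g * h) = (conj_perm g * conj_perm h).
Proof. by apply/permP => y; apply: val_inj; rewrite permM !permE /= conjgM. Qed.

Lemma conj_permP g h :
  conj_perm g = conj_perm h <-> forall y, y \in Y -> y ^ g = y ^ h.
Proof.
split=> [/permP gh y yY|gh].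
  by have /(congr1 val) := gh (SeqSub yY); rewrite !permE.
by apply/permP => y; apply: val_inj; rewrite !permE /=; exact/gh/ssvalP.
Qed.

Lemma card_conj_perm : #|{perm T}| = (size Y)`!.
Proof.
rewrite -(card_seq_sub uY) -(cardsT T) -card_perm.
apply: eq_card => s; rewrite [RHS]unfold_in inE /=.
by apply/esym/fintype.subsetP => x; rewrite inE.
Qed.

Lemma conj_perm1 : conj_perm 1 = 1.
Proof. by apply/permP => y; apply: val_inj; rewrite permE perm1 /= conjg1. Qed.

Lemma conj_permX g n : conj_perm (g ^+ n) = conj_perm g ^+ n.
Proof. by elim: n => [|n IH]; [exact: conj_perm1|rewrite !expgS conj_permM IH]. Qed.

Let K := gen (fun y => y \in Y).
(** [F] is the image of [K] in the symmetric group of [Y]. The function [rep] is a transversal in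
    [K] of the kernel of the action, with the default value 1 outside [F]. *)
Let F : {set {perm T}} := [set f | `[<exists2 g, K g & conj_perm g = f>]].
Let rep (f : {perm T}) : G := xget 1 (fun g => K g /\ conj_perm g = f).

Let K1 : K 1. Proof. exact: gen1. Qed.
Let KM x y : K x -> K y -> K (x * y). Proof. exact: genM. Qed.
Let KV x : K x -> K x^-1. Proof. exact: genV. Qed.

Let repP f : f \in F -> K (rep f) /\ conj_perm (rep f) = f.
Proof.
by rewrite inE => /asboolP [g Kg gf]; rewrite /rep; case: xgetP => // /(_ g)[].
Qed.

Let memF g : K g -> conj_perm g \in F.
Proof. by move=> Kg; rewrite inE; apply/asboolP; exists g. Qed.

Let FM f g : f \in F -> K g -> f * conj_perm g \in F.
Proof.
by move=> /repP [Kf <-] Kg; rewrite -conj_permM; apply: memF; exact: KM.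
Qed.

Let kernel_central g h : conj_perm g = 1 -> K h -> commute g h.
Proof.
move=> g1 Kh; apply: (gen_sub (X := fun y => y \in Y) (D := commute g)) Kh.
  exact: subgroup_commute1.
move=> y yY; apply/commute_sym/commgP/conjg_fixP.
by rewrite -[RHS]conjg1; move: y yY; apply/conj_permP; rewrite g1 conj_perm1.
Qed.

(** The kernel element by which [rep f * g] differs from the representative of its own coset. *)
Let factor g f := rep f * g * (rep (f * conj_perm g))^-1.

Let factorP g f : K g -> f \in F -> K (factor g f) /\ conj_perm (factor g f) = 1.
Proof.
move=> Kg fF; have [Kf fE] := repP fF; have [Kh hE] := repP (FM fF Kg).
split; first by apply: KM; [exact: KM|exact: KV].
apply: (mulIg (conj_perm (rep (f * conj_perm g)))).
by rewrite -conj_permM mulgVK conj_permM fE hE mul1g.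
Qed.

Let factor_commute g h f f' : K g -> K h -> f \in F -> f' \in F ->
  commute (factor g f) (factor h f').
Proof.
move=> Kg Kh fF fF'; apply: kernel_central; first by case: (factorP Kg fF).
by case: (factorP Kh fF').
Qed.

(* The transfer of [K] into its centre, i.e. into the kernel of the action on [Y]. *)
Let transfer g := \prod_(f in F) factor g f.

Let transferM g h : K g -> K h -> transfer (g * h) = transfer g * transfer h.
Proof.
move=> Kg Kh.
(* The inner representatives cancel in each product of two factors. All factors are central in [K],
   so the product splits, and its second half is reindexed by translating [F] by [conj_perm g]. *)
transitivity (\prod_(f in F) (factor g f * factor h (f * conj_perm g))).
  apply: eq_bigr => f _.
  by rewrite /factor conj_permM !mulgA mulgVK.
rewrite prodgM_commute; last first.
  by move=> f f' fF f'F; apply: factor_commute => //; exact: FM.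
congr (_ * _).
rewrite /transfer -[LHS]big_filter -[RHS]big_filter.
rewrite -(big_map (fun f => factor h (f * conj_perm g)) predT id).
rewrite -(big_map (factor h) predT id); set e := [seq f <- _ | _].
have ue : uniq e by exact/filter_uniq/index_enum_uniq.
have me f : (f \in e) = (f \in F) by rewrite mem_filter mem_index_enum andbT.
apply: prodg_perm_commute.
  rewrite (map_comp (factor h)); apply: perm_map.
  have inj : injective (fun f => f * conj_perm g) by exact: mulIg.
  apply: uniq_perm; rewrite ?map_inj_uniq // => f.
  rewrite me; apply/mapP/idP => [[f']|fF].
    by rewrite me => f'F ->; exact: FM.
  exists (f * conj_perm g^-1); first by rewrite me; apply: FM => //; exact: KV.
  by rewrite -mulgA -conj_permM mulVg conj_perm1 mulg1.
move=> _ _ /mapP[f + ->] /mapP[f' + ->]; rewrite !me => fF f'F.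
by apply: factor_commute => //; exact: FM.
Qed.

Let transfer_commute g h : K g -> K h -> commute (transfer g) (transfer h).
Proof.
move=> Kg Kh; apply: commute_prod => f fF; apply/commute_sym/commute_prod => f' f'F.
exact: factor_commute.
Qed.

Let transfer1 : transfer 1 = 1.
Proof. by apply: (mulgI (transfer 1)); rewrite -transferM // !mulg1. Qed.

Let transferV g : K g -> transfer g^-1 = (transfer g)^-1.
Proof.
move=> Kg; apply: (mulgI (transfer g)).
by rewrite -transferM ?mulgV ?transfer1 //; exact: KV.
Qed.

Let transfer_kernel z : K z -> conj_perm z = 1 -> transfer z = z ^+ #|F|.
Proof.
move=> Kz z1; rewrite -prodg_const; apply: eq_bigr => f fF.
rewrite /factor z1 mulg1 (commute_sym (kernel_central z1 _)) ?mulgK //.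
by case: (repP fF).
Qed.

(** The power [#|{perm T}|] of the commutator acts trivially on [Y], and on such elements the
    transfer is the power [#|F|]. But the transfer is a homomorphism with commuting values, so it
    kills commutators. *)
Lemma commg_torsion u v : K u -> K v ->
  [~ u, v] ^+ (#|{perm T}| * #|F|) = 1.
Proof.
move=> Ku Kv; set w := [~ u, v].
have Kw : K w by rewrite /w commgEl conjgE; do ![apply: KM|apply: KV].
have KX n x : K x -> K (x ^+ n).
  by move=> Kx; elim: n => [|n IH]; [exact: K1|rewrite expgS; exact: KM].
have wE1 : conj_perm (w ^+ #|{perm T}|) = 1.
  by rewrite conj_permX -cardsT; apply: expg_cardG; rewrite inE.
rewrite expgnA -transfer_kernel //; last exact: KX.
have trX n : transfer (w ^+ n) = transfer w ^+ n.
  elim: n => [|n IH]; first exact: transfer1.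
  by rewrite !expgS transferM // ?IH //; exact: KX.
have -> : transfer (w ^+ #|{perm T}|) = transfer w ^+ #|{perm T}| by [].
suff -> : transfer w = 1 by rewrite expg1n.
have KVu := KV Ku; have KVv := KV Kv.
rewrite /w commgEl conjgE !transferM ?transferV //; try by do ![apply: KM].
by rewrite (transfer_commute Ku Kv) mulKg mulVg.
Qed.

Lemma commg_exponent : exists e, [/\ (0 < e)%N, (e <= (size Y)`! ^ 2)%N &
  forall u v, K u -> K v -> [~ u, v] ^+ e = 1].
Proof.
exists (#|{perm T}| * #|F|)%N; split; last exact: commg_torsion.
  rewrite muln_gt0 card_conj_perm fact_gt0; apply/card_gt0P.
  by exists (conj_perm 1); apply: memF; exact: K1.
by rewrite -mulnn card_conj_perm leq_mul // -card_conj_perm max_card.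
Qed.

End ConjugationAction.
End FiniteNormalSet.

(** * Groups generated by elements with few conjugates *)

Lemma leq_fact_exp2 n : (n`! <= 2 ^ (n ^ 2))%N.
Proof.
elim: n => // n IH; rewrite factS.
apply: (@leq_trans (2 ^ n.+1 * 2 ^ (n ^ 2))); first by rewrite leq_mul // ltnW // ltn_expl.
by rewrite -expnD leq_pexp2l //; lia.
Qed.

Section NeumannStructure.
Variable G : groupType.
Implicit Types (X D H K Gam : G -> Prop) (s L Y Z : seq G).
Local Open Scope group_scope.

Definition word_of X (j : nat) (g : G) : Prop :=
  exists w : seq G, [/\ size w = j, forall x, x \in w -> X x & g = \prod_(x <- w) x].

Lemma wordM X i j g h : word_of X i g -> word_of X j h -> word_of X (i + j) (g * h).
Proof.
move=> [v [vi vX ->]] [w [wj wX ->]]; exists (v ++ w).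
by split; [rewrite size_cat vi wj|move=> x; rewrite mem_cat => /orP[/vX|/wX]|rewrite big_cat].
Qed.

Lemma word_in X g : X g -> word_of X 1 g.
Proof. by exists [:: g]; split=> // [x|]; rewrite ?big_seq1 // inE => /eqP->. Qed.

Lemma gen_word X g : (forall x, X x -> X x^-1) -> gen X g -> exists j, word_of X j g.
Proof.
move=> XV; elim=> [x Xx||x y _ [i xi] _ [j yj]|x _ [i [w [_ wX ->]]]].
- by exists 1%N; exact: word_in.
- by exists 0%N, [::]; rewrite big_nil.
- by exists (i + j)%N; exact: wordM.
- exists (size w); elim: w wX => [|y w IH] wX.
    by exists [::]; rewrite !big_nil invg1.
  rewrite big_cons invgM /= -addn1; apply: wordM.
    by apply: IH => z zw; apply: wX; rewrite inE zw orbT.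
  by apply/word_in/XV/wX; rewrite inE eqxx.
Qed.

Lemma word_classle X r j g : (forall x, X x -> classle x r) -> word_of X j g ->
  classle g (r ^ j).
Proof.
move=> Xr [w [<- wX ->]]; elim: w wX => [|y w IH] wX.
  by rewrite big_nil; exists [:: 1] => // h; rewrite conj1g inE.
rewrite big_cons expnS; apply: classleM; first by apply/Xr/wX; rewrite inE eqxx.
by apply: IH => z zw; apply: wX; rewrite inE zw orbT.
Qed.

Lemma word_mono X i j g : X 1 -> (i <= j)%N -> word_of X i g -> word_of X j g.
Proof.
move=> X1 /subnK <- gi; rewrite -[g]mul1g; apply: wordM => //.
elim: (j - i)%N => [|n IH]; first by exists [::]; rewrite big_nil.
by rewrite -[1]mul1g -add1n; apply: wordM => //; exact: word_in.
Qed.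

(** If [g] is not a word of length [3 * k], then for every [j <= 3 * k] some word of length [j.+1]
    is not a word of length [j]. Those for [j = 0, 3, ..., 3 * k] are [k.+1] elements with disjoint
    translates of [X], one too many. *)
Lemma gen_word_bound X k g : X 1 -> (forall x, X x -> X x^-1) ->
  index_le (fun=> True) (fun x => exists p q, [/\ X p, X q & x = p * q]) k ->
  gen X g -> word_of X (3 * k) g.
Proof.
move=> X1 XV Xk Gg; apply: contrapT => ng.
have stable j : (forall h, word_of X j.+1 h -> word_of X j h) -> word_of X j g.
  move=> jS; have [i gi] := gen_word XV Gg.
  have : word_of X (i + j) g by apply: word_mono gi => //; rewrite leq_addr.
  elim: i g {gi ng Gg} => // i IH g [w [+ wX ->]].
  case: w wX => // x w wX [wS]; rewrite big_cons.
  apply: jS; rewrite -add1n; apply: wordM; first by apply/word_in/wX; rewrite inE eqxx.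
  by apply: IH; exists w; split=> // y yw; apply: wX; rewrite inE yw orbT.
have /boolp.choice [h hP] : forall j, exists x : G, (j <= 3 * k)%N ->
    word_of X j.+1 x /\ ~ word_of X j x.
  move=> j.
  have [jk|//] := leqP j (3 * k); last by exists 1.
  apply: contrapT => nh; apply: ng; apply: word_mono jk _ => //; apply: stable => x xS.
  by apply: contrapT => nx; apply: nh; exists x.
pose f i := h (3 * i)%N.
(* The element [f i] has length [3 * i + 1]; the letters [p] and [q^-1] raise this to [3 * i + 3],
   which is at most [3 * i']. *)
have fD i i' p q : (i < i' <= k)%N -> X p -> X q -> f i * p = f i' * q -> False.
  move=> /andP[ii' i'k] Xp Xq E.
  have [|fi _] := hP (3 * i)%N; first by lia.
  have [|_] := hP (3 * i')%N; first by lia.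
  apply; apply: (@word_mono _ (3 * i).+3) => //; first by lia.
  have -> : h (3 * i')%N = f i * p * q^-1 by rewrite E mulgK.
  rewrite -[_.+3]addn1 -[_.+2]addn1; apply: wordM; last exact/word_in/XV.
  by apply: wordM => //; exact: word_in.
have finj i i' p q : (i <= k)%N -> (i' <= k)%N -> X p -> X q -> f i * p = f i' * q -> i = i'.
  move=> ik i'k Xp Xq E; have [ii'|ii'|//] := ltngtP i i'.
    by case: (@fD i i' p q); rewrite ?ii'.
  by case: (@fD i' i q p); rewrite ?ii'.
have : (size (map f (iota 0 k.+1)) <= k)%N.
  apply: Xk; split=> //.
    rewrite map_inj_in_uniq ?iota_uniq // => i i'; rewrite !mem_iota !add0n !ltnS.
    by move=> ik i'k E; apply: (finj i i' 1 1) => //; rewrite E.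
  move=> _ _ /mapP[i + ->] /mapP[i' + ->]; rewrite !mem_iota !add0n !ltnS.
  move=> ik i'k [p [q [Xp Xq E]]]; congr f; apply: (finj _ _ p q^-1) => //; first exact: XV.
  have -> : f i' = f i * ((f i)^-1 * f i') by rewrite mulVKg.
  by rewrite E !gnorm.
by rewrite size_map size_iota ltnn.
Qed.

Lemma class_list L r : (forall x, x \in L -> classle x r) ->
  exists Y, [/\ uniq Y, (size Y <= r * size L)%N &
    forall y, y \in Y <-> exists2 x, x \in L & exists g, y = x ^ g].
Proof.
move=> Lr.
have [c cr cL] : exists2 c, (size c <= r * size L)%N &
    forall x g, x \in L -> x ^ g \in c.
  elim: L Lr => [|x L IH] Lr; first by exists [::].
  have [c cL cP] := IH (fun y yL => Lr y (mem_behead (s := x :: L) yL)).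
  have [d dr dP] := Lr x (mem_head x L); exists (d ++ c).
    by rewrite size_cat mulnS leq_add.
  by move=> y g /[!inE] /orP[/eqP->|yL]; rewrite mem_cat ?dP // cP // orbT.
exists (undup [seq y <- c | `[<exists2 x, x \in L & exists g, y = x ^ g>]]); split.
- exact: undup_uniq.
- by rewrite (leq_trans (size_undup _)) // size_filter (leq_trans (count_size _ _)).
- move=> y; rewrite mem_undup mem_filter; split=> [/andP[/asboolP//]|Ly].
  by apply/andP; split; [exact/asboolP|have [x xL [g ->]] := Ly; exact: cL].
Qed.

(** Elements inducing the same permutation of [Y] lie in one coset of its centraliser. *)
Lemma centralizer_index Gam Y : uniq Y -> (forall y g, y \in Y -> y ^ g \in Y) ->
  index_le Gam (fun z => forall y, y \in Y -> commute z y) (size Y)`!.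
Proof.
move=> uY YJ s [us _ sC]; rewrite -(card_conj_perm uY) cardE.
apply: (leq_size_rel (r := fun x f => conj_perm YJ x = f)) => // [x _|x x' f xs x's <- E].
  by exists (conj_perm YJ x) => //; rewrite mem_enum.
apply: sC => // y yY; apply/commute_sym/commgP/conjg_fixP.
by rewrite conjgM (proj1 (conj_permP YJ _ _) E) ?YJ // conjgKV.
Qed.

(** For [Y] closed under conjugation this is the derived subgroup of the group generated by [Y],
    given by at most [size Y ^ 2] generators. *)
Definition derived_gen Y := gen (fun x => exists u v, [/\ u \in Y, v \in Y & x = [~ u, v]]).

Lemma derived_gen_normal Y : (forall y g, y \in Y -> y ^ g \in Y) ->
  is_normal_subgroup (derived_gen Y).
Proof.
move=> YJ; apply: gen_normal => _ g [u [v [uY vY ->]]].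
by exists (u ^ g), (v ^ g); rewrite conjRg; split=> //; exact: YJ.
Qed.

(** The commutators of elements of [Y] form a normal set closed under inverses, with a common
    exponent [e]. Dietzmann's lemma turns every word in them into an ordered product of powers. *)
Lemma derived_gen_list Y : uniq Y -> (forall y g, y \in Y -> y ^ g \in Y) ->
  exists2 c : seq G, (size c <= ((size Y)`! ^ 2) ^ (size Y ^ 2))%N &
    forall x, derived_gen Y x -> x \in c.
Proof.
move=> uY YJ; have [e [e0 eY eP]] := commg_exponent uY YJ.
pose Z := undup [seq [~ u, v] | u <- Y, v <- Y].
have ZP x : x \in Z <-> exists u v, [/\ u \in Y, v \in Y & x = [~ u, v]].
  rewrite mem_undup; split=> [/allpairsP[[u v] /= [uY' vY' ->]]|[u [v [uY' vY' ->]]]].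
    by exists u, v.
  by apply/allpairsP; exists (u, v).
have sZ : (size Z <= size Y ^ 2)%N.
  by rewrite (leq_trans (size_undup _)) // size_allpairs mulnn.
exists (power_products e Z).
  rewrite size_power_products (@leq_trans (e ^ (size Y ^ 2))) //.
    by rewrite leq_pexp2l.
  by case: (size Y ^ 2)%N => // n; rewrite leq_exp2r.
move=> x Hx; have [|j [w [_ wZ ->]]] := gen_word _ Hx.
  by move=> _ [u [v [uY' vY' ->]]]; exists v, u; rewrite invgR.
apply: dietzmann => //; first exact: undup_uniq.
- move=> y z /ZP[u [v [uY' vY' ->]]] _; apply/ZP.
  by exists (u ^ z), (v ^ z); rewrite conjRg; split=> //; exact: YJ.
- by move=> z /ZP[u [v [uY' vY' ->]]]; apply: eP; exact: gen_in.
- by move=> y /wZ /ZP.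
Qed.

(* If [a] has a largest conjugacy class in [Gam] among all elements of [Gam],
   and this class is a single orbit of [K], then for [c] centralising [K] the
   conjugates of [c a] are just the [c a^h] with [h] in [K]. *)
Lemma commg_centralizer Gam K H a c g s :
  is_normal_subgroup H -> is_subgroup Gam -> is_subgroup K ->
  (forall x, K x -> Gam x) -> K a ->
  (forall x y, K x -> K y -> H [~ x, y]) ->
  packing Gam (commute a) s ->
  (forall b, Gam b -> index_le Gam (commute b) (size s)) ->
  (forall x, Gam x -> exists2 h, K h & commute a (h^-1 * x)) ->
  (forall x, K x -> commute c x) -> Gam c -> Gam g -> H [~ c, g].
Proof.
move=> nH [G1 GM GV] [K1 KM KV] KG Ka KH [us sG sa] smax aK cK Gc Gg.
have [[H1 HM HV] _] := nH.
have sC := @subgroup_commute1 G.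
have aJ x : Gam x -> exists2 h, K h & a ^ x = a ^ h.
  move=> Gx; have [h Kh /commgP/conjg_fixP E] := aK _ (GV _ Gx).
  exists h^-1; first exact: KV.
  by rewrite -{1}E -conjgM mulgVK.
have /boolp.choice [f fP] : forall x, exists h, Gam x -> K h /\ commute a (h^-1 * x).
  move=> x; have [Gx|nGx] := pselect (Gam x); last by exists 1.
  by have [h Kh ah] := aK x Gx; exists h.
have fK x : x \in s -> K (f x) by move=> /sG/fP[].
have finj x y : x \in s -> y \in s -> commute a ((f x)^-1 * f y) -> x = y.
  move=> xs ys axy; apply: sa => //.
  have [_ ax] := fP x (sG _ xs); have [_ ay] := fP y (sG _ ys).
  have -> : x^-1 * y = ((f x)^-1 * x)^-1 * ((f x)^-1 * f y) * ((f y)^-1 * y).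
    by rewrite !gnorm.
  by apply: commuteM => //; apply: commuteM => //; exact: commuteV.
(* An element of [K] commutes with [c], so if it commutes with [c * a] it commutes with [a]: the
   class of [c * a] is at least as large as that of [a]. *)
have ps : packing Gam (commute (c * a)) (map f s).
  split.
  - rewrite map_inj_in_uniq // => x y xs ys fE; apply: finj => //.
    by rewrite fE mulVg; exact: commute1.
  - by move=> _ /mapP[x xs ->]; apply/KG/fK.
  - move=> _ _ /mapP[x xs ->] /mapP[y ys ->] caxy; congr f; apply: finj => //.
    have cz : commute c ((f x)^-1 * f y) by apply/cK/KM; [exact/KV/fK|exact: fK].
    move: caxy cz; move: (_^-1 * _) => z caz cz.
    by apply: (mulgI c); rewrite mulgA caz mulgA -cz mulgA.
(* A conjugate of [c * a] outside the orbit of [K] would extend this packing beyond the maximal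
   size. *)
have caJ : exists2 h, K h & (c * a) ^ g = (c * a) ^ h.
  apply: contrapT => nh.
  have /smax : Gam (c * a) by apply: GM => //; exact: KG.
  move=> /(_ (g^-1 :: map f s)) /=; rewrite size_map ltnn; apply/not_implyP; split=> //.
  apply: packing_cons => //; first exact: GV.
  move=> _ /mapP[x xs ->] /commgP/conjg_fixP E; apply: nh; exists (f x)^-1; first exact/KV/fK.
  by rewrite -{1}E -conjgM mulgVK.
have [h Kh] := caJ; rewrite !conjMg.
have [h' Kh' ->] := aJ g Gg; move=> E.
have ch : c ^ h = c by apply/conjg_fixP/commgP/cK.
(* Solving [c ^ g * a ^ h' = c * a ^ h] for [[~ c, g]] leaves only commutators inside [K]. *)
have -> : [~ c, g] = ([~ a, h] * [~ a, h']^-1) ^ a^-1.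
  have -> : [~ c, g] = c^-1 * (c ^ g * a ^ h') * (a ^ h')^-1 by rewrite commgEl !gnorm.
  by rewrite E ch !commgEl !conjgE !gnorm.
by apply: (normal_conjg _ nH); apply: HM; [exact: KH|apply: HV; exact: KH].
Qed.

(** [d] counts at most [3 * k] letters of a word for an element [a] with a largest class, and
    [3 * k * r] generators making that class a single orbit. The at most [r * d] conjugates of these
    have a centraliser of index at most [2 ^ ((r * d) ^ 2)], which costs [(r * d) ^ 2] further
    generators. [M] bounds the number of conjugates of all of them. *)
Theorem finite_derived_subgroup X r k :
  X 1 -> (forall x, X x -> X x^-1) -> (forall x g, X x -> X (x ^ g)) ->
  (forall x, X x -> classle x r) ->
  index_le (fun=> True) (fun x => exists p q, [/\ X p, X q & x = p * q]) k ->
  let d := (3 * k + 3 * k * r)%N in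
  let M := (r * (d + (r * d) ^ 2))%N in
  exists H, [/\ is_normal_subgroup H, forall x, H x -> gen X x,
    forall x y, gen X x -> gen X y -> H [~ x, y] &
    exists2 c : seq G, (size c <= 2 ^ (2 * M ^ 4))%N & forall x, H x -> x \in c].
Proof.
move=> X1 XV XJ Xr Xk d M; set Gam := gen X; pose m := (3 * k)%N.
have sG : is_subgroup Gam := gen_subgroup X.
have nG : is_normal_subgroup Gam by exact: gen_normal.
have [G1 GM GV] := sG.
have Gm g : Gam g -> word_of X m g by exact: gen_word_bound.
have Gr g : Gam g -> classle g (r ^ m) by move=> /Gm; exact: word_classle.
have sC := @subgroup_commute1 G.
have [||n [a [s [Ga pa sn]]] nmax] :=
  @max_nat (fun n => exists a s, [/\ Gam a, packing Gam (commute a) s & size s = n]) (r ^ m).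
- by exists 0%N, 1, [::].
- by move=> _ [b [s [Gb ps <-]]]; exact: classle_packing (Gr b Gb) ps.
have smax b : Gam b -> index_le Gam (commute b) (size s).
  by move=> Gb s' ps'; rewrite sn; apply: nmax; exists b, s'.
have [La [sLa LaX aE]] := Gm a Ga.
(* The centraliser of [a] has index at most [r ^ m <= 2 ^ (m * r)]. The normal closure of [Lb] meets
   all its cosets in [Gam], hence acts transitively on the class of [a]. *)
have [Lb [sLb LbX LbP]] : exists L, [/\ (size L <= m * r)%N, forall x, x \in L -> X x &
    forall g, Gam g -> exists n d, [/\ nclos L n, commute a d & g = n * d]].
  apply: normal_generators => //; first exact: gen_in.
  move=> s' ps'; apply: leq_trans (classle_packing (Gr a Ga) ps') _.
  by rewrite mulnC expnM; case: (m) => // q; rewrite leq_exp2r // ltnW // ltn_expl.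
pose L0 := La ++ Lb.
have sL0 : (size L0 <= d)%N by rewrite size_cat sLa leq_add2l.
have L0X x : x \in L0 -> X x by rewrite mem_cat => /orP[/LaX|/LbX].
have [Y0 [uY0 sY0 Y0P]] := class_list (fun x xL => Xr x (L0X x xL)).
have conj_closed (L Y : seq G) : (forall y, y \in Y <-> exists2 x, x \in L & exists g, y = x ^ g) ->
    forall y g, y \in Y -> y ^ g \in Y.
  move=> YP y g /YP [x xL [h ->]]; apply/YP; exists x => //.
  by exists (h * g); rewrite conjgM.
have Y0J := conj_closed _ _ Y0P.
pose C0 z := forall y, y \in Y0 -> commute z y.
have C0t : index_le Gam C0 (2 ^ ((r * d) ^ 2)).
  move=> s' ps'; apply: leq_trans (centralizer_index uY0 Y0J ps') _.
  apply: leq_trans (leq_fact_exp2 _) _; rewrite leq_pexp2l // leq_exp2r //.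
  by apply: leq_trans sY0 _; rewrite leq_mul2l sL0 orbT.
have [Lc [sLc LcX LcP]] := normal_generators (subgroup_commute _) sG (@gen_in G X)
  (fun g Gg => Gg) C0t.
pose L1 := L0 ++ Lc.
have L1X x : x \in L1 -> X x by rewrite mem_cat => /orP[/L0X|/LcX].
have [Y1 [uY1 sY1 Y1P]] := class_list (fun x xL => Xr x (L1X x xL)).
have Y1J := conj_closed _ _ Y1P.
have Y1M : (size Y1 <= M)%N.
  by rewrite (leq_trans sY1) // leq_mul2l size_cat leq_add ?orbT.
pose H := derived_gen Y1.
have nH : is_normal_subgroup H by exact: derived_gen_normal.
have [[H1 HM HV] _] := nH.
pose K1 := nclos L1.
have K1H x y : K1 x -> K1 y -> H [~ x, y].
  apply: (commg_gen nH) => u v /Y1P uY /Y1P vY; apply: gen_in.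
  by exists u, v.
have K1G x : K1 x -> Gam x.
  by apply: (nclos_sub nG) => y /L1X; exact: gen_in.
pose K0 := nclos L0.
have K01 x : K0 x -> K1 x by apply: nclos_mono => y yL; rewrite mem_cat yL.
have sK0 : is_subgroup K0 by exact: gen_subgroup.
have sK1 : is_subgroup K1 by exact: gen_subgroup.
have [_ K1M K1V] := sK1.
have K0a : K0 a.
  rewrite aE big_seq; apply: (big_ind K0); [exact: gen1|exact: genM|].
  by move=> x xL; apply: nclos_mem; rewrite mem_cat xL.
have C0K0 z x : C0 z -> K0 x -> commute z x.
  move=> zC; apply: (gen_sub (sC z)) => y yL; apply: zC.
  exact/Y0P.
have C0H c g : C0 c -> Gam c -> Gam g -> H [~ c, g].
  move=> cC Gc Gg; apply: (@commg_centralizer Gam K0 H a c g s) => //.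
  - by move=> x /K01 /K1G.
  - by move=> x y /K01 K1x /K01 K1y; exact: K1H.
  - move=> x /LbP [h [z [Kh az ->]]]; exists h; last by rewrite mulKg.
    by apply: nclos_mono Kh => y yL; rewrite mem_cat yL orbT.
  - by move=> x; exact: C0K0.
exists H; split=> //.
- apply: gen_sub => // _ [u [v [uY vY ->]]].
  have Gu w : w \in Y1 -> Gam w.
    by move=> /Y1P [x /L1X Xx [g ->]]; apply/gen_in/XJ.
  by rewrite commgEl conjgE; do ![apply: (GM)|apply: (GV)|exact: Gu].
(* [Gam] is generated by [K1] and the elements of [Gam] centralising [K0], so commutators need
   checking on these only. *)
- pose A x := K1 x \/ C0 x /\ Gam x.
  have AG x : A x -> Gam x by case=> [/K1G|[]].
  have GA g : Gam g -> gen A g.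
    move=> Gg; have [h [z [Kh Cz E]]] := LcP g Gg.
    have K1h : K1 h by apply: nclos_mono Kh => y yL; rewrite mem_cat yL orbT.
    rewrite E; apply: genM; apply: gen_in; [by left|right; split=> //].
    have -> : z = h^-1 * g by rewrite E mulKg.
    by apply: (GM) => //; exact/GV/K1G.
  move=> x y /GA Ax /GA Ay; apply: (commg_gen nH) Ax Ay => u v.
  move=> [K1u|[Cu Gu]] Av; last by apply: C0H => //; exact: AG.
  case: Av => [K1v|[Cv Gv]]; first exact: K1H.
  by rewrite -invgR; apply: (HV); apply: C0H => //; exact: K1G.
- have [c cY cH] := derived_gen_list uY1 Y1J; exists c => //.
  apply: leq_trans cY _; apply: (@leq_trans ((2 ^ (2 * M ^ 2)) ^ (M ^ 2))).
    apply: (@leq_trans ((2 ^ (2 * M ^ 2)) ^ (size Y1 ^ 2))).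
      case: (size Y1 ^ 2)%N => // q; rewrite leq_exp2r // mulnC expnM leq_exp2r //.
      apply: leq_trans (leq_fact_exp2 _) _; rewrite leq_pexp2l // leq_exp2r //.
    by rewrite leq_pexp2l ?expn_gt0 // leq_exp2r.
  by rewrite -expnM -mulnA -expnD.
Qed.

End NeumannStructure.

(** * Counting in balls *)

Lemma leq_sum_if (T : Type) (A : seq T) (P : pred T) (c : T -> nat) r a b :
  (forall x, r * c x <= if P x then a else b)%N ->
  (r * \sum_(x <- A) c x <= count P A * a + count (predC P) A * b)%N.
Proof.
move=> cP; elim: A => [|x A IH]; first by rewrite big_nil muln0.
rewrite big_cons mulnDr /= !mulnDl addnACA leq_add //.
by apply: leq_trans (cP x) _; case: (P x); rewrite /= !mul1n mul0n ?addn0.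
Qed.

Section Balls.
Variable G : groupType.
Variable S : seq G.
Hypothesis S1 : 1%g \in S.
Hypothesis Sgen : forall g : G, exists n, g \in spow S n.
Implicit Types (D X : G -> Prop) (s : seq G).
Local Open Scope group_scope.
Local Notation B := (spow S).

Lemma mem_spow0 x : (x \in B 0) = (x == 1).
Proof. by rewrite mem_undup inE. Qed.

Lemma mem_spowS n x :
  x \in B n.+1 <-> exists a b, [/\ a \in B n, b \in S & x = a * b].
Proof.
rewrite mem_undup /=; split=> [/allpairsP[[a b] /= [an bS ->]]|[a [b [an bS ->]]]].
  by exists a, b; rewrite mem_undup.
by apply/allpairsP; exists (a, b); rewrite mem_undup in an.
Qed.

Lemma spow_in x : x \in S -> x \in B 1.
Proof. by move=> xS; apply/mem_spowS; exists 1, x; rewrite mem_spow0 mul1g eqxx. Qed.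

Lemma spowM m n x y : x \in B m -> y \in B n -> x * y \in B (m + n).
Proof.
move=> xm; elim: n y => [|n IH] y.
  by rewrite mem_spow0 addn0 => /eqP->; rewrite mulg1.
move=> /mem_spowS [a [b [an bS ->]]]; rewrite addnS; apply/mem_spowS.
by exists (x * a), b; rewrite mulgA; split=> //; exact: IH.
Qed.

Lemma spow_one n : 1 \in B n.
Proof.
elim: n => [|n IH]; first by rewrite mem_spow0.
by apply/mem_spowS; exists 1, 1; rewrite mulg1.
Qed.

Lemma spow_mono m n x : (m <= n)%N -> x \in B m -> x \in B n.
Proof. by move=> /subnKC <- xm; rewrite -[x]mulg1; apply: spowM => //; exact: spow_one. Qed.

Lemma spow_seq s : exists t, forall x, x \in s -> x \in B t.
Proof.
elim: s => [|x s [t st]]; first by exists 0%N.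
have [n xn] := Sgen x; exists (maxn n t) => y /[!inE] /orP[/eqP->|/st].
  by apply: spow_mono xn; exact: leq_maxl.
by apply: spow_mono; exact: leq_maxr.
Qed.

Lemma size_spow_gt0 n : (0 < size (B n))%N.
Proof. by rewrite lt0n size_eq0; apply/eqP => E; have := spow_one n; rewrite E. Qed.

(** The translates by [s] of the part of the ball satisfying [P] are disjoint and stay in the ball
    of radius [t + n]. *)
Lemma count_translates (P : pred G) s t n : uniq s ->
  (forall x, x \in s -> x \in B t) ->
  (forall x y p q, x \in s -> y \in s -> P p -> P q -> x * p = y * q -> x = y) ->
  (size s * count P (B n) <= size (B (t + n)))%N.
Proof.
move=> us sB sP; rewrite -size_filter -(size_allpairs (fun x y => x * y)).
apply: uniq_leq_size.
  apply: allpairs_uniq => //; first by rewrite filter_uniq ?undup_uniq.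
  move=> [x p] [y q] /allpairsP[[x' p'] /= [xs + [-> ->]]].
  rewrite mem_filter => /andP[Pp _] /allpairsP[[y' q'] /= [ys + [-> ->]]].
  rewrite mem_filter => /andP[Pq _] E.
  have xy := sP _ _ _ _ xs ys Pp Pq E; rewrite xy in E *.
  by rewrite (mulgI _ _ _ E).
move=> _ /allpairsP[[x p] /= [xs + ->]]; rewrite mem_filter => /andP[_ pn].
by apply: spowM => //; exact: sB.
Qed.

Lemma count_packing D s t n : is_subgroup D -> packing (fun=> True) D s ->
  (forall x, x \in s -> x \in B t) ->
  (size s * count (fun x => `[<D x>]) (B n) <= size (B (t + n)))%N.
Proof.
move=> [D1 DM DV] [us _ sD] sB; apply: count_translates => // x y p q xs ys.
move=> /asboolP Dp /asboolP Dq E; apply: sD => //.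
have -> : x^-1 * y = p * q^-1 by rewrite -[p](mulKg x) E !gnorm.
by apply: (DM) => //; exact: DV.
Qed.

(* If the translates by [S] of the cosets met by [s'] produced no new coset,
   these cosets would cover [G]. *)
Lemma short_packing D s : is_subgroup D -> packing (fun=> True) D s ->
  exists s', [/\ packing (fun=> True) D s', size s' = size s &
    forall x, x \in s' -> x \in B (size s)].
Proof.
move=> sD [us _ ps]; have [D1 DM DV] := sD.
have [->|s0] := posnP (size s); first by exists [::].
(* Keeping [j.+1] representatives within radius [j] lets the induction start from the identity
   alone. *)
suff main j : (j < size s)%N -> exists s', [/\ packing (fun=> True) D s',
    size s' = j.+1 & forall x, x \in s' -> x \in B j].
  have [|s' [ps' sz s'B]] := main (size s).-1; first by rewrite prednK.
  exists s'; split=> //; first by rewrite sz prednK.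
  by move=> x /s'B; apply: spow_mono; exact: leq_pred.
elim: j => [_|j IH js].
  exists [:: 1]; split=> //.
  by split=> // x y /[!inE] /eqP-> /eqP->.
have [s' [ps' sz s'B]] := IH (ltnW js).
have ncover : ~ forall g, exists2 x, x \in s' & D (x^-1 * g).
  move=> cov; suff : (size s <= size s')%N by rewrite sz leqNgt js.
  apply: (leq_size_rel (r := fun g x => D (x^-1 * g))) => // g g' x gs g's Dg Dg'.
  apply: ps => //; have -> : g^-1 * g' = (x^-1 * g)^-1 * (x^-1 * g') by rewrite !gnorm.
  by apply: (DM) => //; exact: DV.
have [sg [x [sgS xs new]]] : exists sg x, [/\ sg \in S, x \in s' &
    forall y, y \in s' -> ~ D (y^-1 * (sg * x))].
  apply: contrapT => old; apply: ncover => g.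
  have step sg x : sg \in S -> x \in s' -> exists2 y, y \in s' & D (y^-1 * (sg * x)).
    move=> sgS xs; apply: contrapT => nD; apply: old; exists sg, x; split=> // y ys Dy.
    by apply: nD; exists y.
  have walk n w x : w \in B n -> x \in s' -> exists2 y, y \in s' & D (y^-1 * (w * x)).
    elim: n w x => [|n IHn] w x.
      by rewrite mem_spow0 => /eqP-> xs; exists x => //; rewrite mul1g mulVg.
    move=> /mem_spowS [a [sg [an sgS ->]]] xs.
    have [y ys Dy] := step sg x sgS xs; have [z zs Dz] := IHn a y an ys.
    exists z => //; have -> : z^-1 * (a * sg * x) = z^-1 * (a * y) * (y^-1 * (sg * x)).
      by rewrite !gnorm.
    exact: DM.
  case: s' sz {ps' s'B IH js old step} walk => // x s' _ walk.
  have [n gn] := Sgen (g * x^-1).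
  have [y ys] := walk n _ x gn (mem_head _ _); rewrite mulgVK => Dy.
  by exists y.
exists (sg * x :: s'); split=> /=; last 1 first.
- move=> y /[!inE] /orP[/eqP->|/s'B]; last by apply: spow_mono.
  by rewrite -add1n; apply: spowM; [exact: spow_in|exact: s'B].
- exact: packing_cons.
- by rewrite sz.
Qed.

(** The radius depends on the number of cosets alone; this is the uniformity that allows averaging
    over all centralisers. *)
Lemma count_index D s n : is_subgroup D -> packing (fun=> True) D s ->
  (size s * count (fun x => `[<D x>]) (B n) <= size (B (size s + n)))%N.
Proof.
by move=> sD /(short_packing sD) [s' [ps' <- s'B]]; exact: count_packing.
Qed.

Lemma ncomm_sum (A : seq G) :
  ncomm A = (\sum_(x <- A) count (fun y => (x * y == y * x)%g) A)%N.
Proof.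
rewrite /ncomm count_flatten -map_comp sumnE big_map; apply: eq_bigr => x _ /=.
by rewrite count_map; apply: eq_count.
Qed.

(** An element of [X] commutes with at most the whole ball, any other with at most
    [size (B (r + n)) / r] elements of it, its centraliser having index at least [r]. *)
Lemma ncomm_bound X r n :
  (forall x, ~ X x -> exists2 s, packing (fun=> True) (commute x) s & size s = r) ->
  let z := count (fun x => `[<X x>]) (B n) in
  (z <= size (B n))%N /\
  (r * ncomm (B n) <= r * (z * size (B n)) + (size (B n) - z) * size (B (r + n)))%N.
Proof.
move=> Xr z; have zB : (z <= size (B n))%N by exact: count_size.
split=> //; rewrite ncomm_sum mulnCA.
have <- : count (predC (fun x => `[<X x>])) (B n) = (size (B n) - z)%N.
  by rewrite -(count_predC (fun x => `[<X x>]) (B n)) addKn.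
apply: leq_sum_if => x; case: ifPn => [_|/asboolPn /Xr [s ps <-]].
  by rewrite leq_mul2l count_size orbT.
rewrite (eq_count (a2 := fun y => `[<commute x y>])); last first.
  by move=> y; apply/eqP/asboolP.
by apply: count_index => //; exact: subgroup_commute1.
Qed.

End Balls.

(** Here [mu] is the density of [X], [q] the number of its disjoint translates and [d] the commuting
    probability in one ball. If [q * mu <= 1 + e], then up to errors of order [e] one gets [1 / K <=
    d <= 1 / (K + 1) + 1 / (2 * N + 1)] with [N = K * (K + 1)]. This fails because
    [1 / K - 1 / (K + 1) = 1 / N]. *)
Lemma density_gt (R : realFieldType) (K e q mu d alpha : R) :
  0 < K -> 0 < e -> e * (4 * K * (K + 3)) = 1 -> K^-1 <= alpha -> K + 1 <= q ->
  0 <= mu -> mu <= 1 -> alpha - e < d ->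
  (2 * K * (K + 1) + 1) * d <= (2 * K * (K + 1) + 1) * mu + (1 - mu) * (1 + e) ->
  1 + e < q * mu.
Proof.
move=> K0 e0 eE ka qK mu0 mu1 dlt dle; rewrite ltNge; apply/negP => qmu.
have Ka : 1 <= K * alpha by rewrite mulrC -ler_pdivrMr // mul1r.
have Kmu : (K + 1) * mu <= 1 + e by apply: le_trans qmu; rewrite ler_wpM2r.
have Kd : 1 - K * e <= K * d by nra.
pose N : R := K * (K + 1).
have N0 : 0 < N by rewrite mulr_gt0 // addr_gt0.
have NE : 2 * K * (K + 1) = 2 * N by rewrite /N mulrA.
rewrite NE in dle.
have up : (2 * N + 1) * d <= (2 * N + 1) * mu + (1 + e) by nra.
have up' : N * ((2 * N + 1) * d) <= N * ((2 * N + 1) * mu + (1 + e)).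
  by rewrite ler_wpM2l // ltW.
have lo : (2 * N + 1) * (K + 1) * (1 - K * e) <= (2 * N + 1) * (K + 1) * (K * d).
  by rewrite ler_wpM2l // mulr_ge0 //; lra.
have hi : K * ((2 * N + 1) * ((K + 1) * mu)) <= K * ((2 * N + 1) * (1 + e)).
  by apply: ler_wpM2l; [exact: ltW|apply: ler_wpM2l => //; lra].
(* The left side is [1 / N - 1 / (2 * N + 1)] multiplied by [N * (2 * N + 1)]; the right side
   collects all error terms. *)
have : N + 1 <= e * ((2 * N + 1) * (K * (K + 2)) + N).
  suff -> : e * ((2 * N + 1) * (K * (K + 2)) + N) = N + 1 +
    (K * ((2 * N + 1) * (1 + e)) - K * ((2 * N + 1) * ((K + 1) * mu))) +
    ((2 * N + 1) * (K + 1) * (K * d) - (2 * N + 1) * (K + 1) * (1 - K * e)) +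
    (N * ((2 * N + 1) * mu + (1 + e)) - N * ((2 * N + 1) * d)) by lra.
  rewrite /N; ring.
have E1 : N + 1 = e * ((N + 1) * (4 * K * (K + 3))) by rewrite mulrCA eE mulr1.
apply/negP; rewrite -ltNge [ltRHS]E1.
by rewrite ltr_pM2l // /N; nra.
Qed.

(** * The commuting probability *)

Section CommutingProbability.
Variables (R : realType) (G : groupType) (S : seq G).
Hypothesis goodS : good_genset R S.
Implicit Types (D X : G -> Prop) (s : seq G).
Local Notation b n := ((size (spow S n))%:R : R).
Local Notation dc n := (dc_n R S n).

Let S1 : 1%g \in S. Proof. by case: goodS. Qed.
Let Sgen (g : G) : exists n, g \in spow S n. Proof. by case: goodS => _ _ /(_ g). Qed.

Lemma size_spow_pos n : 0 < b n.
Proof. by rewrite ltr0n size_spow_gt0. Qed.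

Lemma cvg_ball_ratio t : ((fun n => b (t + n) / b n) @ \oo --> (1 : R))%classic.
Proof.
elim: t => [|t IH].
  rewrite (_ : (fun _ => _) = fun=> 1); first exact: cvg_cst.
  by apply/funext => n; rewrite add0n divff // gt_eqF // size_spow_pos.
rewrite (_ : (fun _ => _) = (fun n => b (n + t).+1 / b (n + t)%N) \* (fun n => b (t + n) / b n)).
  have [_ _ _ r1] := goodS.
  have r1t : ((fun n => b (n + t).+1 / b (n + t)%N) @ \oo --> (1 : R))%classic.
    by move: r1; rewrite -(cvg_shiftn t).
  have := cvgM r1t IH; rewrite (mulr1 (1 : R)); apply.
apply/funext => n /=; rewrite addSn (addnC n t).
by rewrite mulrA mulfVK // gt_eqF // size_spow_pos.
Qed.

Lemma ball_ratio t (e : R) : 0 < e ->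
  exists N, forall n, (N <= n)%N -> b (t + n) <= (1 + e) * b n.
Proof.
move=> e0; have lt1e : 1 < 1 + e by rewrite ltrDl.
have [N _ NP] := @cvgr_le _ _ _ _ _ _ (cvg_ball_ratio t) _ lt1e.
exists N => n /NP /=; rewrite ler_pdivrMr //; exact: size_spow_pos.
Qed.

Lemma dc_n_ge0 n : 0 <= dc n.
Proof. by rewrite divr_ge0. Qed.

Lemma dc_n_le1 n : dc n <= 1.
Proof.
rewrite ler_pdivrMr ?mul1r ?ler_nat ?ltr0n ?expn_gt0 ?size_spow_gt0 //.
by rewrite (leq_trans (count_size _ _)) // size_allpairs mulnn.
Qed.

Lemma dcS_le (c : R) :
  (forall e, 0 < e -> exists N, forall n, (N <= n)%N -> dc n <= c + e) ->
  dcS R S <= c.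
Proof.
move=> ec; apply/ler_addgt0Pr => e /ec [N NP].
have ub : has_ubound (range (dc_n R S)).
  by exists 1 => _ [n _ <-]; exact: dc_n_le1.
have lb : has_lbound (range (dc_n R S)).
  by exists 0 => _ [n _ <-]; exact: dc_n_ge0.
have supN : sups (dc_n R S) N <= c + e.
  apply: ge_sup; first by exists (dc N), N => /=.
  by move=> _ [n /= Nn <-]; exact: NP.
(* As the sequence is bounded, the limit superior is the infimum of the tail suprema, so one tail
   supremum bounds it. *)
rewrite /dcS /limn_sup (cvg_lim _ (cvg_sups_inf ub lb)) //.
apply: le_trans supN; apply: ge_inf; last by exists N.
exists 0 => _ [n _ <-]; apply: (@le_trans _ _ (dc n)); first exact: dc_n_ge0.
apply: ub_le_sup; last by exists n => /=.
by exists 1 => _ [m _ <-]; exact: dc_n_le1.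
Qed.

Lemma dcS_le1 : dcS R S <= 1.
Proof.
apply: dcS_le => e e0; exists 0%N => n _.
by apply: le_trans (dc_n_le1 n) _; rewrite lerDl ltW.
Qed.

Lemma dcS_often (c : R) N : c < dcS R S -> exists2 n, (N <= n)%N & c < dc n.
Proof.
move=> cdc; apply: contrapT => nex; move: cdc; apply/negP; rewrite -leNgt.
apply: dcS_le => e e0; exists N => n Nn; rewrite leNgt; apply/negP => ce.
by apply: nex; exists n => //; apply: lt_trans ce; rewrite ltrDl.
Qed.

Lemma dc_n_bound X r n (e : R) : (0 < r)%N -> b (r + n) <= (1 + e) * b n ->
  (forall x, ~ X x -> exists2 s, packing (fun=> True) (commute x) s & size s = r) ->
  let mu := (count (fun x => `[<X x>]) (spow S n))%:R / b n in
  0 <= mu <= 1 /\ r%:R * dc n <= r%:R * mu + (1 - mu) * (1 + e).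
Proof.
move=> r0 rn Xr mu; have [zB] := ncomm_bound S1 Sgen n Xr.
rewrite -(ler_nat R) !natrD !natrM natrB // => bound.
have b0 := size_spow_pos n; have bn0 : b n != 0 by rewrite gt_eqF.
set z := (count _ _)%:R in bound mu *.
have zE : z = mu * b n by rewrite /mu mulfVK.
have mu1 : mu <= 1 by rewrite /mu ler_pdivrMr // mul1r ler_nat.
split; first by rewrite mu1 andbT divr_ge0.
rewrite /dc_n natrX mulrA ler_pdivrMr ?exprn_gt0 //.
apply: (le_trans bound); rewrite zE.
have -> : (r%:R * mu + (1 - mu) * (1 + e)) * b n ^+ 2 =
    r%:R * (mu * b n * b n) + (1 - mu) * b n * ((1 + e) * b n) by ring.
rewrite lerD2l (_ : b n - mu * b n = (1 - mu) * b n); last by ring.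
by rewrite ler_wpM2l // mulr_ge0 ?subr_ge0 // ltW.
Qed.

Lemma density_packing D s n (e : R) : is_subgroup D -> packing (fun=> True) D s ->
  b (size s + n) <= (1 + e) * b n ->
  (size s)%:R * ((count (fun x => `[<D x>]) (spow S n))%:R / b n) <= 1 + e.
Proof.
move=> sD ps sn; rewrite mulrA ler_pdivrMr ?size_spow_pos //.
by apply: le_trans sn; rewrite -natrM ler_nat; exact: count_index.
Qed.

Lemma center_subgroup : is_subgroup (@center_of G).
Proof.
split=> [g|x y xZ yZ g|x xZ g]; first by rewrite mul1g mulg1.
  by rewrite -mulgA (yZ g) (mulgA x) (xZ g) mulgA.
by apply: (mulgI x); rewrite mulVKg mulgA xZ mulgK.
Qed.

(** Noncentral elements have centralisers of index at least 2. If [mu] is the density of the centre,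
    the commuting probability is thus at most [mu + (1 - mu) / 2] up to a small error, and [mu] is
    at most about [1 / size s]. *)
Lemma dcS_center s : packing (fun=> True) (@center_of G) s -> (0 < size s)%N ->
  dcS R S <= 1 / 2 + (2 * (size s)%:R)^-1.
Proof.
move=> ps s0; apply: dcS_le => e e0.
have [N1 N1P] := ball_ratio 2 e0; have [N2 N2P] := ball_ratio (size s) e0.
exists (maxn N1 N2) => n; rewrite geq_max => /andP[/N1P b2 /N2P bs].
have := density_packing center_subgroup ps bs.
have [//|x nZ|/andP[mu0 mu1] dc2] := @dc_n_bound (@center_of G) 2 n e _ b2.
  have /existsNP [g xg] : ~ center_of x := nZ.
  exists [:: g; 1%g] => //; apply: packing_cons => //; first exact: subgroup_commute1.
    split=> // y z /[!inE] /eqP-> /eqP-> //.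
  by move=> y /[!inE] /eqP->; rewrite invg1 mul1g.
set mu := (_ / _) in mu0 mu1 dc2 *.
have q1 : (1 : R) <= (size s)%:R by rewrite ler1n.
have q0 : 0 < (size s)%:R :> R by rewrite ltr0n.
rewrite -ler_pdivlMl // => muq.
have iq1 : (size s)%:R^-1 <= 1 :> R by rewrite invf_le1.
rewrite invfM; set i := (size s)%:R^-1 in muq iq1 *.
have i0 : 0 < i by rewrite invr_gt0.
nra.
Qed.

(** If [x] and [y] do not commute, then [1], [x], [y], [x * y] lie in distinct cosets of the centre,
    and four cosets give the bound [1 / 2 + 1 / 8 = 5 / 8]. *)
Lemma abelian_of_dcS : 5 / 8 < dcS R S -> forall x y : G, (x * y = y * x)%g.
Proof.
move=> dcS58 x y; apply: contrapT => nxy; have sZ := center_subgroup.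
have p1 : packing (fun=> True) (@center_of G) [:: 1%g].
  by split=> // u v /[!inE] /eqP-> /eqP->.
have p2 : packing (fun=> True) (@center_of G) [:: x; 1%g].
  apply: packing_cons => // z /[!inE] /eqP->; rewrite invg1 mul1g => xZ.
  by apply: nxy; exact: xZ.
have p3 : packing (fun=> True) (@center_of G) [:: y; x; 1%g].
  apply: packing_cons => // z /[!inE] /orP[] /eqP-> zZ; apply: nxy.
    by have := zZ x; rewrite mulKVg -mulgA => /(congr1 (mulg x)); rewrite mulVKg.
  by move: zZ; rewrite invg1 mul1g => ->.
have p4 : packing (fun=> True) (@center_of G) [:: (x * y)%g; y; x; 1%g].
  apply: packing_cons => // z /[!inE] /or3P[] /eqP-> zZ; apply: nxy.
  - have := zZ y; rewrite mulVKg -!mulgA => /(congr1 (mulg y)).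
    by rewrite mulVKg !mulgA => /mulIg.
  - by move: zZ; rewrite mulKg => ->.
  - by move: (zZ x); rewrite invg1 mul1g -mulgA => /mulgI.
by have := dcS_center p4 isT; rewrite /=; lra.
Qed.

Lemma center_index (e : R) : 0 < e -> 1 / 2 + e <= dcS R S ->
  subgroup_index_le (@center_of G) e^-1.
Proof.
move=> e0 he.
have bound s : packing (fun=> True) (@center_of G) s -> (size s)%:R <= e^-1.
  move=> ps; have [->|s0] := posnP (size s); first by rewrite invr_ge0 ltW.
  (* Cancelling [1 / 2] leaves [e <= 1 / (2 * size s)], hence [size s <= 2 * size s <= e^-1]. *)
  have := le_trans he (dcS_center ps s0); rewrite lerD2l.
  have q0 : 0 < (size s)%:R :> R by rewrite ltr0n.
  rewrite invfM -[leLHS]invrK -[leRHS]invrK lef_pV2 ?posrE ?invr_gt0 ?mulr_gt0 ?invr_gt0 //.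
  rewrite invfM !invrK => q2; apply: le_trans q2; rewrite ler_peMl ?ltW //.
  by rewrite ltr1n.
have [||s ps cov] := @packing_cover G (fun=> True) (@center_of G) (Num.bound e^-1).
- exact: center_subgroup.
- move=> s /bound sb; rewrite -(ler_nat R) (le_trans sb) // ltW // archi_boundP //.
  by rewrite invr_ge0 ltW.
exists s; split; first exact: bound.
move=> g; have [//|x xs Zx] := cov g; exists x => //.
by exists (x^-1 * g)%g; rewrite mulVKg.
Qed.

(** If more than [k] translates by [s] of the set of elements with at most [r] conjugates were
    disjoint, its density [mu] would satisfy [size s * mu <= 1 + e] in all large balls, but
    [density_gt] gives the opposite for arbitrarily large radii. *)
Lemma class_density (k r : nat) (alpha : R) : (0 < k)%N -> r = (2 * k * k.+1)%N ->
  k%:R^-1 <= alpha -> alpha <= dcS R S ->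
  index_le (fun=> True)
    (fun x : G => exists p q, [/\ classle p r, classle q r & x = (p * q)%g]) k.
Proof.
move=> k0 rE ka adc s [us _ sXX]; rewrite leqNgt; apply/negP => ks.
have kR : 0 < k%:R :> R by rewrite ltr0n.
pose e : R := (4 * k%:R * (k%:R + 3))^-1.
have e0 : 0 < e by rewrite invr_gt0 !mulr_gt0 ?addr_gt0.
(* The set of products is no subgroup, so the packing is not shortened; but [s] is fixed, and any
   ball containing it will do. *)
have [t st] := spow_seq S1 Sgen s.
have [N1 N1P] := ball_ratio r.+1 e0; have [N2 N2P] := ball_ratio t e0.
have [|n] := @dcS_often (alpha - e) (maxn N1 N2).
  by apply: lt_le_trans adc; rewrite ltrBlDr ltrDl.
rewrite geq_max => /andP[/N1P br /N2P bt] dcn.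
have [//|x nX|/andP[mu0 mu1]] := @dc_n_bound (fun x => classle x r) r.+1 n e _ br.
  (* An element with more than [r] conjugates has a centraliser of index above [r]; its packing is
     cut down to exactly [r.+1] elements. *)
  have /existsNP [s' /not_implyP [ps' /negP]] : ~ index_le (fun=> True) (commute x) r.
    by move=> /(classle_index (subgroup_commute1 x)) cx; apply: nX; exact: cx.
  rewrite -ltnNge => rs'; exists (take r.+1 s'); last by rewrite size_takel.
  have [us' _ s'C] := ps'; split=> // [|y z ys zs]; first exact: take_uniq.
  by apply: s'C; [exact: mem_take ys|exact: mem_take zs].
set P := (fun x => _) in mu0 mu1 *; set mu := (_ / _) in mu0 mu1 *.
move=> dcmu; have : (size s)%:R * mu <= 1 + e.
  rewrite mulrA ler_pdivrMr ?size_spow_pos //; apply: le_trans bt.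
  rewrite -natrM ler_nat; apply: count_translates => // x y p q xs ys.
  move=> /asboolP Xp /asboolP [c cr qc] E; apply: sXX => //.
  exists p, q^-1%g; split=> //; last by rewrite -[p](mulKg x) E mulgA mulgK.
  exists [seq z^-1%g | z <- c]; first by rewrite size_map.
  by move=> h; rewrite conjVg map_f.
have sk : k%:R + 1 <= (size s)%:R :> R by rewrite natr1 ler_nat.
have rR : r.+1%:R = 2 * k%:R * (k%:R + 1) + 1 :> R by rewrite rE -[LHS]natr1 !natrM -[k.+1%:R]natr1.
rewrite rR in dcmu.
apply/negP; rewrite -ltNge.
apply: (density_gt _ e0 _ ka sk mu0 mu1 dcn dcmu) => //.
by rewrite mulVf // gt_eqF // -invr_gt0.
Qed.

End CommutingProbability.

(** * Explicit constants and the assembly of the three statements *)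

Lemma derived_bound_poly k r d : (0 < k)%N ->
  r = (2 * k * k.+1)%N -> d = (3 * k + 3 * k * r)%N ->
  (r * (d + (r * d) ^ 2) <= 2 ^ 14 * k ^ 12)%N.
Proof.
move=> k0 rE dE.
have r4 : (r <= 4 * k ^ 2)%N by rewrite rE; nia.
have d15 : (d <= 15 * k ^ 3)%N.
  rewrite dE; apply: (@leq_trans (3 * k + 3 * k * (4 * k ^ 2))); first by rewrite leq_add2l leq_mul.
  have -> : (3 * k * (4 * k ^ 2) = 12 * k ^ 3)%N by ring.
  have : (k <= k ^ 3)%N by rewrite -{1}[k]expn1 leq_pexp2l.
  lia.
have rd : ((r * d) ^ 2 <= 3600 * k ^ 10)%N.
  apply: (@leq_trans ((4 * k ^ 2 * (15 * k ^ 3)) ^ 2)); first by rewrite leq_exp2r // leq_mul.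
  by apply: eq_leq; ring.
apply: (@leq_trans (4 * k ^ 2 * (15 * k ^ 10 + 3600 * k ^ 10))).
  rewrite leq_mul // leq_add //; apply: (leq_trans d15).
  by rewrite leq_mul2l leq_pexp2l.
(* The coefficient fits because [2 ^ 14 = 16384]. *)
have -> : (4 * k ^ 2 * (15 * k ^ 10 + 3600 * k ^ 10) = 14460 * k ^ 12)%N by ring.
by rewrite leq_mul2r; apply/orP; right.
Qed.

Lemma exp2_le_expR (R : realType) n : (2 ^ n)%:R <= expR (n%:R : R).
Proof.
rewrite natrX -[n%:R]mulr1 expRM_natl; apply: lerXn2r; rewrite ?nnegrE ?expR_ge0 //.
exact: expR_ge1Dx.
Qed.

(** The left side is [2 ^ 57 * k ^ 48], hence at most [2 ^ 105 * alpha ^ (-48)]; this explains the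
    threshold 105, and [48 <= 2 ^ 6 <= 2 ^ n] handles the exponent. *)
Lemma powRN_bound (R : realType) (alpha : R) k n : 0 < alpha <= 1 ->
  k%:R <= 2 * alpha^-1 -> (105 <= n)%N ->
  (2 * (2 ^ 14 * k ^ 12) ^ 4)%:R <= 2 ^+ n * alpha `^ (- 2 ^+ n) :> R.
Proof.
move=> /andP[a0 a1] ka n105.
have -> : (2 * (2 ^ 14 * k ^ 12) ^ 4)%:R = 2 ^+ 57 * k%:R ^+ 48 :> R.
  by rewrite natrM natrX natrM !natrX exprMn -!exprM mulrA -exprS.
apply: (@le_trans _ _ (2 ^+ 57 * (2 * alpha^-1) ^+ 48)).
  by rewrite ler_pM2l ?exprn_gt0 // lerXn2r ?nnegrE ?mulr_ge0 ?invr_ge0 // ltW.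
rewrite exprMn mulrA -exprD.
apply: ler_pM; [by rewrite exprn_ge0|by rewrite exprn_ge0 // invr_ge0 ltW| |].
  by rewrite ler_weXn2l // ler1n.
rewrite powRN exprVn lef_pV2 ?posrE ?exprn_gt0 ?powR_gt0 //.
rewrite -(powR_mulrn 48 (ltW a0)); apply: ger_powR; first by rewrite a0.
apply: (@le_trans _ _ (2 ^+ 6)).
  by rewrite -natrX ler_nat.
by rewrite ler_weXn2l ?ler1n // (leq_trans _ n105).
Qed.

Theorem theorem1p5 (R : realType) :
  (forall (G : groupType) (S : seq G), good_genset R S ->
     (5 / 8 < dcS R S -> forall x y : G, (x * y = y * x)%g) /\
     (forall eps : R, 0 < eps -> 1 / 2 + eps <= dcS R S ->
        subgroup_index_le (@center_of G) eps^-1)) /\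
  (exists C : R, 0 < C /\
     forall (G : groupType) (S : seq G), good_genset R S ->
     forall alpha : R, 0 < alpha -> alpha <= dcS R S ->
     exists (Gam H : G -> Prop),
       [/\ is_normal_subgroup Gam /\ is_normal_subgroup H,
           subgroup_index_le Gam ((Num.ceil alpha^-1)%:~R : R),
           fincard_le H (expR (C * alpha `^ (- C))),
           (forall x, H x -> Gam x) &
           (forall x y, Gam x -> Gam y -> H [~ x, y]%g)]).
Proof.
split=> [G S goodS|].
  by split=> [|eps]; [exact: abelian_of_dcS|exact: center_index].
(* One constant serves both as the factor and as the exponent, so it is chosen for the larger
   demand, the factor. *)
exists (2 ^+ 105); split=> [|G S goodS alpha a0 adc]; first by rewrite exprn_gt0.
have a1 : alpha <= 1 := le_trans adc (dcS_le1 goodS).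
have ia1 : 1 <= alpha^-1 by rewrite invf_ge1.
have c0 : 0 < Num.ceil alpha^-1 by rewrite ceil_gt0 invr_gt0.
pose k := `|Num.ceil alpha^-1|%N.
have kE : (Num.ceil alpha^-1)%:~R = k%:R :> R.
  by rewrite -[in LHS](gez0_abs (ltW c0)).
have k0 : (0 < k)%N by rewrite absz_gt0 gt_eqF.
have ka : k%:R^-1 <= alpha.
  rewrite -[alpha]invrK lef_pV2 ?posrE ?invr_gt0 ?ltr0n // -kE; exact: ceil_ge.
have k2 : k%:R <= 2 * alpha^-1.
  have : (Num.ceil alpha^-1 - 1)%:~R < alpha^-1 by exact: ceilB1_lt.
  rewrite intrB kE; lra.
pose r := (2 * k * k.+1)%N; pose X (x : G) := classle x r.
have Xk := class_density goodS k0 erefl ka adc : index_le (fun=> True) (fun x => exists p q, [/\ X p, X q & x = p * q]%g) k.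
have r0 : (0 < r)%N by rewrite !muln_gt0 k0.
have X1 : X 1%g by exists [:: 1%g] => // h; rewrite conj1g inE.
have XV x : X x -> X x^-1%g.
  move=> [c cr cx]; exists [seq z^-1%g | z <- c]; first by rewrite size_map.
  by move=> h; rewrite conjVg map_f.
have XJ x g : X x -> X (x ^ g)%g.
  by move=> [c cr cx]; exists c => // h; rewrite -conjgM.
have [H [nH HG GH [c cM Hc]]] := finite_derived_subgroup X1 XV XJ (fun x Xx => Xx) Xk.
have nG : is_normal_subgroup (gen X) by exact: gen_normal.
exists (gen X), H; split=> //.
(* Products of two elements of [X] lie in [gen X], so distinct cosets of [gen X] give disjoint
   translates of [X]. *)
- have bound s : packing (fun=> True) (gen X) s -> (size s <= k)%N.
    move=> [us _ sG]; apply: Xk; split=> // x y xs ys [p [q [Xp Xq E]]].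
    by apply: sG => //; rewrite E; apply: genM; exact: gen_in.
  have [s ps cov] := packing_cover (proj1 nG) bound.
  exists s; rewrite kE ler_nat bound //; split=> // g.
  have [//|x xs Gx] := cov g; exists x => //.
  by exists (x^-1 * g)%g; rewrite mulVKg.
- exists (undup [seq x <- c | `[<H x>]]); split.
  + exact: undup_uniq.
  + move=> x; rewrite mem_undup mem_filter; split=> [Hx|/andP[/asboolP]//].
    by apply/andP; split; [exact/asboolP|exact: Hc].
  + apply: (@le_trans _ _ (size c)%:R).
      by rewrite ler_nat (leq_trans (size_undup _)) // size_filter count_size.
    apply: (@le_trans _ _ (2 ^ (2 * (2 ^ 14 * k ^ 12) ^ 4))%:R).
      rewrite ler_nat (leq_trans cM) // leq_pexp2l // leq_mul2l leq_exp2r //.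
      exact: derived_bound_poly k0 erefl erefl.
    apply: (le_trans (exp2_le_expR _ _)); rewrite ler_expR.
    by apply: powRN_bound => //; rewrite a0.
Qed.
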